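(* Let $d\ge 1$ and let $W:\mathbb{R}^d\to\mathbb{R}\cup\{+\infty\}$ be a measurable function satisfying all of the following: (1) $W$ is bounded from below by a finite constant $W_{\min}<0$; (2) $W$ is locally integrable, i.e. $\int_B |W|<+\infty$ for every open ball $B\subset\mathbb{R}^d$; (3) $W(x)=W(-x)$ for all $x\in\mathbb{R}^d$; (4) the limit $W_\infty:=\lim_{|x|\to\infty}W(x)$ exists (possibly equal to $+\infty$) and there is $\mu\in\mathcal{P}(\mathbb{R}^d)$ with $E(\mu)<\frac12 W_\infty$; (5) $W$ is lower semi-continuous. Suppose moreover that there exists a global minimiser $\rho\in\mathcal{P}(\mathbb{R}^d)$ of the energy $E$. Then $\rho$ is compactly supported.
   Context: $\mathcal{P}(\mathbb{R}^d)$ denotes the set of (Borel) probability measures on $\mathbb{R}^d$. The interaction energy $E:\mathcal{P}(\mathbb{R}^d)\to\mathbb{R}\cup\{+\infty\}$ is $$E(\rho)=\frac12\int_{\mathbb{R}^d\times\mathbb{R}^d}W(x-y)\,d\rho(x)\,d\rho(y),$$ which is well defined because $W$ is bounded from below. A global minimiser of $E$ is a $\rho\in\mathcal{P}(\mathbb{R}^d)$ with $E(\rho)\le E(\mu)$ for all $\mu\in\mathcal{P}(\mathbb{R}^d)$. *)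

(* Defs.v *)
From HB Require Import structures.
From mathcomp Require Import all_boot all_order all_algebra.
From mathcomp Require Import all_classical all_reals all_analysis.
From mathcomp Require Import measurable_realfun.

Set Implicit Arguments.
Unset Strict Implicit.
Unset Printing Implicit Defensive.

Import Order.TTheory GRing.Theory Num.Theory.
Import numFieldNormedType.Exports.

Local Open Scope classical_set_scope.
Local Open Scope ring_scope.

(* R^d is 'rV[R]_d with the library topology (the product topology). The
   library norm on row vectors is the sup norm, hence [norm2]. *)

Section euclidean_norm.
Context {R : realType} {d : nat}.

Definition norm2 (x : 'rV[R]_d) : R := Num.sqrt (\sum_(i < d) x 0 i ^+ 2).

Definition ball2 (c : 'rV[R]_d) (r : R) : set 'rV[R]_d :=
  [set x | norm2 (x - c) < r].

(* the filter of |x| -> +oo *)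
Definition norm2_pinfty : set_system 'rV[R]_d :=
  filter_from [set: R] (fun M => [set x | M < norm2 x]).

End euclidean_norm.

Definition borel_rV_display : measure_display.
Proof. exact: default_measure_display. Qed.

Section borel.
Context {R : realType} {d : nat}.

Let borel_set0 : <<s @open 'rV[R]_d >> set0.
Proof. exact: sigma_algebra0. Qed.

Let borel_setC (A : set 'rV[R]_d) : <<s open >> A -> <<s open >> (~` A).
Proof. exact: sigma_algebraC. Qed.

Let borel_bigcup (F : (set 'rV[R]_d)^nat) :
  (forall i, <<s open >> (F i)) -> <<s open >> (\bigcup_i F i).
Proof. exact: sigma_algebra_bigcup. Qed.

HB.instance Definition _ := @isMeasurable.Build
  borel_rV_display 'rV[R]_d <<s open >>
  borel_set0 borel_setC borel_bigcup.

Lemma open_measurable_rV (U : set 'rV[R]_d) : open U -> measurable U.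
Proof. exact: sub_sigma_algebra. Qed.

End borel.

Section lebesgue.
Context {R : realType}.

Definition rV_cons n (p : 'rV[R]_n * measurableTypeR R) : 'rV[R]_n.+1 :=
  \row_(i < n.+1) oapp (fun j => p.1 0 j) p.2 (unlift 0 i).

Lemma open_bigcup_ball d (U : set 'rV[R]_d) : open U ->
  U = \bigcup_(q in [set q : 'rV[rat]_d * nat |
    ball (map_mx ratr q.1 : 'rV[R]_d) q.2.+1%:R^-1 `<=` U])
    ball (map_mx ratr q.1 : 'rV[R]_d) q.2.+1%:R^-1.
Proof.
move=> oU; apply/seteqP; split=> [x Ux|x [q /= + xq]]; last exact.
have /nbhs_ballP[e /= e0 eU] : nbhs x U by exact: open_nbhs_nbhs.
have [k _ /(_ k (leqnn k)) /= ke] := near_infty_natSinv_lt (PosNum (divr_gt0 e0 (ltr0n R 2))).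
set r := _^-1 in ke.
have r0 : 0 < r by rewrite invr_gt0.
have /choice[q qx] (i : 'I_d) :
    exists q : rat, ratr q \in `]x 0 i - r, x 0 i + r[.
  by apply: rat_in_itvoo; rewrite ltrBlDr -addrA ltrDl addr_gt0.
have xq : ball (map_mx ratr (\row_i q i) : 'rV[R]_d) r x.
  split=> // i j; rewrite ord1 !mxE /ball /= distrC.
  by have := qx j; rewrite in_itv /= -ltr_distl distrC.
exists (\row_i q i, k) => //= y qy; apply: eU.
rewrite (splitr e); apply: (@ball_triangle _ _ (map_mx ratr (\row_i q i) : 'rV[R]_d)).
  by apply/ball_sym; apply: le_ball xq; exact: ltW.
by apply: le_ball qy; exact: ltW.
Qed.

Lemma measurable_rV_cons n : measurable_fun setT (@rV_cons n).
Proof.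
apply: (@measurability _ _ _ _ _ _ (@open 'rV[R]_n.+1)).
  by [].
move=> _ [U oU <-].
rewrite setTI (open_bigcup_ball oU) bigcup_mkcond preimage_bigcup.
apply: countable_bigcupT_measurable => // -[q k].
case: ifPn => _; last by rewrite preimage_set0.
set r := _^-1; have r0 : 0 < r by rewrite invr_gt0.
rewrite [X in measurable X](_ : _ =
  ball (\row_i ratr (q 0 (lift 0 i)) : 'rV[R]_n) r `*`
  ball (ratr (q 0 0) : R) r).
  apply: measurableX; last exact: measurable_ball.
  by apply: open_measurable_rV; exact: ball_open.
apply/seteqP; split=> -[y t] /= [].
  move=> _ yt; split.
    split=> // i j; rewrite ord1; have := yt 0 (lift 0 j).
    by rewrite !mxE liftK.
  by have := yt 0 0; rewrite !mxE unlift_none.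
move=> [_ qy] qt; split=> // i j; rewrite ord1 !mxE.
case: unliftP => [l ->|->] //=.
by have := qy 0 l; rewrite !mxE.
Qed.

Section product.
Variables (n : nat) (mu : {measure set 'rV[R]_n -> \bar R}).

(* the product of [mu] and the Lebesgue measure on R, carried over to R^n.+1 *)
Definition rV_prod : set 'rV[R]_n.+1 -> \bar R :=
  pushforward (mu \x @lebesgue_measure R)%E (@rV_cons n).

HB.instance Definition _ := isMeasurableFun.Build _ _ _ _ (@rV_cons n)
  (@measurable_rV_cons n).

Let rV_prod0 : rV_prod set0 = 0%E.
Proof. exact: measure0. Qed.

Let rV_prod_ge0 A : (0 <= rV_prod A)%E.
Proof. exact: measure_ge0. Qed.

Let rV_prod_sigma_additive : semi_sigma_additive rV_prod.
Proof. exact: measure_semi_sigma_additive. Qed.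

HB.instance Definition _ := isMeasure.Build _ _ _ rV_prod
  rV_prod0 rV_prod_ge0 rV_prod_sigma_additive.

End product.

(* R^0 is a point, of mass 1 *)
Fixpoint lebesgue_rV (d : nat) : {measure set 'rV[R]_d -> \bar R} :=
  match d with
  | 0 => \d_(0 : 'rV[R]_0)
  | n.+1 => rV_prod (lebesgue_rV n)
  end.

Let box_measurable d (a b : 'rV[R]_d) :
  measurable [set x : 'rV[R]_d | forall i, x 0 i \in `[a 0 i, b 0 i]].
Proof.
rewrite (_ : mkset _ = \bigcap_(i in [set: 'I_d])
    ((fun x : 'rV[R]_d => x 0 i) @^-1` `[a 0 i, b 0 i])); last first.
  by apply/seteqP; split=> x /= xab i; [move=> _|]; exact: xab.
apply: fin_bigcap_measurable => // i _.
rewrite -[X in measurable X]setCK; apply: measurableC.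
apply: open_measurable_rV; apply: closed_openC.
apply: preimage_closed => [x _|]; last exact: interval_closed.
exact: (@coord_continuous R 1 d 0 i).
Qed.

(* this property characterises the Lebesgue measure among Borel measures *)
Lemma lebesgue_rV_box d (a b : 'rV[R]_d) : (forall i, a 0 i <= b 0 i) ->
  lebesgue_rV d [set x : 'rV[R]_d | forall i, x 0 i \in `[a 0 i, b 0 i]] =
  (\prod_(i < d) (b 0 i - a 0 i))%:E.
Proof.
elim: d a b => [|d IH] a b ab /=.
  by rewrite diracE big_ord0 mem_set//= => -[].
pose a' : 'rV[R]_d := \row_j a 0 (lift 0 j).
pose b' : 'rV[R]_d := \row_j b 0 (lift 0 j).
rewrite /rV_prod /pushforward (_ : _ @^-1` _ =
  [set x : 'rV[R]_d | forall i, x 0 i \in `[a' 0 i, b' 0 i]] `*`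
  `[a 0 0, b 0 0]%classic); last first.
  apply/seteqP; split=> -[x t] /=.
    move=> xt; split=> [i|].
      by have := xt (lift 0 i); rewrite !mxE liftK.
    by have := xt 0; rewrite !mxE unlift_none.
  move=> [xab tab] i; rewrite !mxE; case: unliftP => [j ->|->] //=.
  by have := xab j; rewrite !mxE.
have := product_measure1E (lebesgue_rV d) (@lebesgue_measure R)
  (box_measurable a' b') (measurable_itv `[a 0 0, b 0 0]).
move=> /= ->.
rewrite IH; last by move=> i; rewrite !mxE.
rewrite lebesgue_measure_itv /= lte_fin big_ord_recl mulrC EFinM.
under eq_bigr do rewrite !mxE.
case: ltP => // ba0; congr (_ * _)%E.
by rewrite (@le_anti _ _ (a 0 0) (b 0 0)) ?subrr// ab ba0.
Qed.

End lebesgue.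

Section energy.
Context {R : realType} {d : nat}.
Implicit Types (W : 'rV[R]_d -> \bar R) (rho : probability 'rV[R]_d R).

Definition energy W rho : \bar R :=
  ((2^-1)%:E * \int[rho \x rho]_z W (z.1 - z.2)%R)%E.

Definition global_minimiser W rho :=
  forall mu : probability 'rV[R]_d R, (energy W rho <= energy W mu)%E.

Definition measure_support rho : set 'rV[R]_d :=
  [set x | forall U, open U -> U x -> (0 < rho U)%E].

Definition compactly_supported rho := compact (measure_support rho).

End energy.

(* Main.v *)
Require Import Defs.
From mathcomp Require Import all_boot all_order all_algebra.
From mathcomp Require Import all_classical all_reals all_analysis.
From mathcomp Require Import measurable_realfun ring lra.

Set Implicit Arguments.
Unset Strict Implicit.
Unset Printing Implicit Defensive.

Import Order.TTheory GRing.Theory Num.Theory.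
Import numFieldNormedType.Exports.

Local Open Scope classical_set_scope.
Local Open Scope ring_scope.

(** The support is bounded because the potential of the minimiser is too large
    far away from the origin.

    Subtract the lower bound [Wmin] from [W]. This gives a nonnegative symmetric
    kernel V(x, y) = W(x - y) - Wmin, and the energy of a probability measure is
    half of the double integral of V plus half of [Wmin]. So [rho] minimises the
    quadratic form I(P, P), where I(P, Q) is the integral of V against P x Q, and
    nonnegativity lets Tonelli's theorem handle every integral. Put
    e = I(rho, rho) and let psi(x) be the integral of V(x, y) against rho(dy).

    - First variation ([minimiser_interaction_le]). Comparing [rho] with the
      mixtures (1 - t) rho + t Q and letting t go to 0 shows e <= I(rho, Q) for
      every Q with I(Q, Q) finite: along the mixtures the form is a quadratic
      polynomial in t, with slope 2 (I(rho, Q) - e) at t = 0.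

    - Concentration ([minimiser_concentrated]). Suppose that psi >= r > e outside
      a set B of positive mass. With Q the measure [rho] conditioned on B, the
      first variation says that psi has mean at least e over B; since it is at
      least r > e outside B while its overall mean is e, the complement of B has
      mass 0.

    - Behaviour at infinity ([potential_ge_far]). Instability says
      e < Winf - Wmin, so there is a real l > e with V(x, y) >= l as soon as
      x - y is large. A large ball carries almost all of the mass of [rho], hence
      psi is at least any prescribed r < l outside a still larger ball.

    Choosing e < r < l, all the mass of [rho] lies in a ball B, which contains the
    support. The support is closed, hence compact. *)

(** * Mixtures and conditioning of probability measures *)

Section mixture.
Context d (T : measurableType d) (R : realType).
Variables (P Q : probability T R) (s t : R).
Hypotheses (s_ge0 : 0 <= s) (t_ge0 : 0 <= t) (st1 : s + t = 1).

Let mix : {measure set T -> \bar R} :=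
  measure_add (mscale (NngNum s_ge0) P) (mscale (NngNum t_ge0) Q).

Let mixE A : mix A = (s%:E * P A + t%:E * Q A)%E.
Proof. exact: measure_addE. Qed.

(** The conclusion records only the integrals of nonnegative functions because
    this is how the mixture enters the interaction. *)
Lemma exists_mixture : exists M : probability T R,
  forall f : T -> \bar R, measurable_fun setT f -> (forall x, (0 <= f x)%E) ->
  (\int[M]_x f x = s%:E * \int[P]_x f x + t%:E * \int[Q]_x f x)%E.
Proof.
have mixT : mix setT = 1%E.
  by rewrite mixE (probability_setT P) (probability_setT Q) !mule1 -EFinD st1.
(* The total mass is already 1: normalising only supplies the probability
   structure, and its default measure [P] is never selected. *)
exists (mnormalize mix P) => f mf f0.
rewrite (_ : \int[_]_x f x = \int[mix]_x f x)%E; last first.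
  apply: eq_measure_integral => A mA _ /=.
  by rewrite /mnormalize mixT onee_eq0 /= invr1 mule1.
rewrite ge0_integral_measure_add//.
by rewrite !ge0_integral_mscale.
Qed.

End mixture.

Section conditioning.
Context d (T : measurableType d) (R : realType).
Variables (P : probability T R) (B : set T).
Hypotheses (mB : measurable B) (PB0 : (0 < P B)%E).

(** The factor [P B] is kept on the left, so that no division by an extended
    real is needed. *)
Lemma exists_conditioning : exists Q : probability T R,
  forall f : T -> \bar R, measurable_fun setT f -> (forall x, (0 <= f x)%E) ->
  (P B * \int[Q]_x f x = \int[P]_(x in B) f x)%E.
Proof.
have PBfin : P B \is a fin_num by exact: fin_num_measure.
have PBr0 : 0 < fine (P B) by rewrite fine_gt0// PB0 ltey_eq PBfin.
pose Q := mnormalize (mrestr P mB) P.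
have QE A : Q A = (P (A `&` B) * (fine (P B))^-1%:E)%E.
  have restrT : mrestr P mB setT = P B by rewrite /mrestr setTI.
  rewrite /Q /mnormalize /= restrT.
  by rewrite gt_eqF//= lt_eqF// ltey_eq PBfin.
exists Q => f mf f0.
have QB : Q (~` B) = 0%E by rewrite QE setICl measure0 mul0e.
rewrite -(setUv B) ge0_integral_setU//; last 3 first.
- exact: measurableC.
- by rewrite setUv.
- by apply/disj_setPS => x [].
rewrite (null_set_integral _ _ QB)//; last 2 first.
- exact: measurableC.
- exact: measurable_funS mf.
have c0 : 0 <= (fine (P B))^-1 by rewrite invr_ge0 ltW.
rewrite adde0 (eq_measure_integral (mscale (NngNum c0) P)); last first.
  move=> A mA AB; have /setIidPl {2}<- := AB.
  by rewrite [LHS]QE muleC.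
rewrite ge0_integral_mscale//; last exact: measurable_funS mf.
by rewrite muleA -{1}(fineK PBfin) -EFinM divff ?gt_eqF// mul1e.
Qed.

End conditioning.

(** * Minimisers of a nonnegative quadratic interaction *)

Section interaction.
Context d (T : measurableType d) (R : realType) (V : T * T -> \bar R).
Hypotheses (mV : measurable_fun setT V) (V_ge0 : forall z, (0 <= V z)%E)
  (V_sym : forall x y, V (x, y) = V (y, x)).
Implicit Types P Q M : probability T R.

Definition potential P x := (\int[P]_y V (x, y))%E.

Definition interaction P Q := (\int[P]_x potential Q x)%E.

Lemma potential_ge0 P x : (0 <= potential P x)%E.
Proof. by apply: integral_ge0. Qed.

Lemma measurable_potential P : measurable_fun setT (potential P).
Proof. exact: (measurable_fun_fubini_tonelli_F (m2 := P) V). Qed.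

Lemma interaction_ge0 P Q : (0 <= interaction P Q)%E.
Proof. by apply: integral_ge0 => x _; exact: potential_ge0. Qed.

Lemma interactionE P Q : (\int[P \x Q]_z V z = interaction P Q)%E.
Proof. exact: fubini_tonelli1. Qed.

Lemma interactionC P Q : interaction P Q = interaction Q P.
Proof.
rewrite /interaction /potential (@fubini_tonelli _ _ _ _ _ P Q V mV V_ge0).
by apply: eq_integral => y _; apply: eq_integral => x _.
Qed.

(** The first variation of P |-> I(P, P) at a minimiser, in the direction Q - P.
    Finiteness of the three interactions turns the comparison with a mixture
    into an inequality between real quadratic polynomials in t. *)
Lemma minimiser_interaction_le P Q :
  (forall M, (interaction P P <= interaction M M)%E) ->
  (interaction P P < +oo)%E -> (interaction Q Q < +oo)%E ->
  (interaction P P <= interaction P Q)%E.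
Proof.
move=> minP; rewrite -!ge0_fin_numE ?interaction_ge0// => Pfin Qfin.
have [/eqP ->|] := boolP (interaction P Q == +oo)%E; first exact: leey.
rewrite -ltey -ge0_fin_numE ?interaction_ge0// => PQfin.
have [a aE] : exists a, interaction P P = a%:E.
  by exists (fine (interaction P P)); rewrite fineK.
have [b bE] : exists b, interaction P Q = b%:E.
  by exists (fine (interaction P Q)); rewrite fineK.
have [c cE] : exists c, interaction Q Q = c%:E.
  by exists (fine (interaction Q Q)); rewrite fineK.
have a0 : 0 <= a by rewrite -lee_fin -aE interaction_ge0.
have b0 : 0 <= b by rewrite -lee_fin -bE interaction_ge0.
have c0 : 0 <= c by rewrite -lee_fin -cE interaction_ge0.
have quad t : 0 <= t <= 1 ->
    a <= (1 - t) ^+ 2 * a + 2 * ((1 - t) * t) * b + t ^+ 2 * c.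
  move=> /andP[t0 t1]; have s0 : 0 <= 1 - t by rewrite subr_ge0.
  have st1 : 1 - t + t = 1 by rewrite subrK.
  have [M ME] := exists_mixture P Q s0 t0 st1.
  have interM N : interaction M N =
      ((1 - t)%:E * interaction P N + t%:E * interaction Q N)%E.
    by apply: ME; [exact: measurable_potential|exact: potential_ge0].
  have := minP M.
  rewrite interM (interactionC P M) (interactionC Q M) !interM.
  rewrite (interactionC Q P) aE bE cE -!(EFinM, EFinD) lee_fin.
  by move=> /le_trans; apply; lra.
rewrite aE bE lee_fin leNgt; apply/negP => ba.
(* As b >= 0, the inequality [quad] gives 2 (a - b) <= t (a + c) for t > 0;
   this t is at most 1 and makes the right-hand side less than a - b. *)
pose t := (a - b) / (a + c + 1).
have ac0 : 0 < a + c + 1 by lra.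
have tac : t * (a + c + 1) = a - b by rewrite mulfVK// gt_eqF.
have t0 : 0 < t by apply: divr_gt0 => //; lra.
have t1 : t <= 1 by rewrite ler_pdivrMr// mul1r; lra.
have /quad : 0 <= t <= 1 by rewrite (ltW t0).
suff : t * (t * (a + c + 1)) < t * (2 * (a - b)).
  by have := mulr_ge0 (mulr_ge0 (ltW t0) (ltW t0)) b0; nra.
by rewrite tac ltr_pM2l//; lra.
Qed.

(** Conditioning on [B] is an admissible competitor in the first variation, which
    bounds the mean of the potential over [B] from below by e = I(P, P). Since
    the mean of the potential over the whole space is e too, any mass outside
    [B], where the potential is at least [r] > e, would make that mean exceed
    e. *)
Lemma minimiser_concentrated P B r : measurable B -> (0 < P B)%E ->
  (forall M, (interaction P P <= interaction M M)%E) ->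
  (interaction P P < r%:E)%E ->
  (forall x, ~ B x -> (r%:E <= potential P x)%E) ->
  P (~` B) = 0%E.
Proof.
move=> mB PB0 minP Pr psir.
have mC : measurable (~` B) by exact: measurableC.
have Poo : (interaction P P < +oo)%E by rewrite (lt_trans Pr)// ltry.
have Pfin : interaction P P \is a fin_num.
  by rewrite ge0_fin_numE// interaction_ge0.
have PBfin : P B \is a fin_num by exact: fin_num_measure.
have PCfin : P (~` B) \is a fin_num by exact: fin_num_measure.
have [Q QE] := exists_conditioning mB PB0.
have QP : (P B * interaction Q P = \int[P]_(x in B) potential P x)%E.
  by apply: QE; [exact: measurable_potential|exact: potential_ge0].
have split M : (interaction P M = \int[P]_(x in B) potential M x
                 + \int[P]_(x in ~` B) potential M x)%E.
  rewrite -ge0_integral_setU ?setUv//.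
  - exact: measurable_potential.
  - by move=> x _; exact: potential_ge0.
  - by apply/disj_setPS => x [].
have le_split M : (\int[P]_(x in B) potential M x <= interaction P M)%E.
  by rewrite split leeDl// integral_ge0// => x _; exact: potential_ge0.
(* The conditioned measure has finite interactions because it is at most a
   multiple of [P]. *)
have QPoo : (interaction Q P < +oo)%E.
  rewrite ltey; apply/negP => /eqP QPoo.
  have := le_split P; rewrite -QP QPoo gt0_muley// leye_eq => /eqP Poo'.
  by rewrite Poo' in Poo.
have QQoo : (interaction Q Q < +oo)%E.
  rewrite ltey; apply/negP => /eqP QQoo.
  have QQ : (P B * interaction Q Q = \int[P]_(x in B) potential Q x)%E.
    by apply: QE; [exact: measurable_potential|exact: potential_ge0].
  have := le_split Q; rewrite -QQ QQoo gt0_muley// leye_eq interactionC.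
  by move=> /eqP QPoo'; rewrite QPoo' in QPoo.
have EL := minimiser_interaction_le minP Poo QQoo.
have C_ge : (r%:E * P (~` B) <= \int[P]_(x in ~` B) potential P x)%E.
  rewrite -integral_cst//; apply: ge0_le_integral => //.
  - by move=> x _; exact: le_trans (interaction_ge0 P P) (ltW Pr).
  - exact: measurable_funS (measurable_potential P).
have PBC : (P B + P (~` B) = 1)%E.
  rewrite -measureU//; last by rewrite setICr.
  by rewrite setUv; exact: probability_setT.
have EL' : (P B * interaction P P + r%:E * P (~` B) <= interaction P P)%E.
  by rewrite [leRHS]split leeD// -QP (interactionC Q P) lee_pmul2l.
move: Pr PBC EL'; rewrite -(fineK Pfin) -(fineK PBfin) -(fineK PCfin).
have : 0 <= fine (P (~` B)) by rewrite fine_ge0.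
move: (fine (interaction P P)) (fine (P B)) (fine (P (~` B))) => a p q.
rewrite -!EFinM -!EFinD !lee_fin lte_fin => q0 ar [pq1] h.
congr EFin; apply/eqP; rewrite eq_le q0 andbT.
have : q * (r - a) <= 0.
  rewrite (_ : q * (r - a) = p * a + r * q - (p + q) * a); last by ring.
  by rewrite pq1 mul1r subr_le0.
by rewrite pmulr_lle0// subr_gt0.
Qed.

End interaction.

(** * Integrals of functions bounded from below *)

(** Valid even when the integral is infinite, where linearity of the integral is
    not available. The negative part of [f] is bounded, so its integral is
    finite; rearranging f = f^+ - f^- into an identity between sums of
    nonnegative functions makes additivity applicable. *)
Lemma integral_shift_bounded_below d (T : measurableType d) (R : realType)
    (P : probability T R) (f : T -> \bar R) (c : R) :
  measurable_fun setT f -> c <= 0 -> (forall x, (c%:E <= f x)%E) ->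
  (\int[P]_x f x = \int[P]_x (f x - c%:E) + c%:E)%E.
Proof.
move=> mf c0 cf.
have mg : measurable_fun setT (fun x => (f x - c%:E)%E).
  exact: emeasurable_funB.
have g0 x : (0 <= f x - c%:E)%E by rewrite sube_ge0.
have nc0 : 0 <= - c by rewrite oppr_ge0.
have fneg_le x : (f^\- x <= (- c)%:E)%E.
  by rewrite funenegE ge_max lee_fin nc0 andbT EFinN leeN2.
have int_cst : (\int[P]_x (- c)%:E = (- c)%:E)%E.
  by rewrite integral_cst// [X in (_ * X)%E]probability_setT mule1.
have fneg_fin : (\int[P]_x f^\- x)%E \is a fin_num.
  rewrite ge0_fin_numE ?integral_ge0//.
  apply: le_lt_trans (ltry (- c)); rewrite -int_cst.
  apply: ge0_le_integral => //; exact: measurable_funeneg.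
have fposE : (\int[P]_x f^\+ x + (- c)%:E =
    \int[P]_x (f x - c%:E) + \int[P]_x f^\- x)%E.
  rewrite -{1}int_cst -!ge0_integralD//; last 2 first.
  - exact: measurable_funeneg.
  - exact: measurable_funepos.
  have fE x : f x = (f^\+ x - f^\- x)%E.
    exact: (congr1 (@^~ x) (funeposneg f)).
  apply: eq_integral => x _; rewrite fE EFinN.
  have : (f^\- x)%E \is a fin_num.
    by rewrite ge0_fin_numE// (le_lt_trans (fneg_le x))// ltry.
  by move=> ?; rewrite addeAC subeK.
rewrite integralE.
have -> : (\int[P]_x f^\+ x =
    \int[P]_x (f x - c%:E) + \int[P]_x f^\- x + c%:E)%E.
  by rewrite -fposE EFinN subeK.
by rewrite addeAC addeK.
Qed.

(** * Borel sets and compact supports in Euclidean space *)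

Section euclidean.
Context {R : realType} {d : nat}.

(** Compactness and the triangle inequality are used in the sup norm, whereas the
    limit of the kernel at infinity is taken in the Euclidean norm; points that
    are far away for the former are far away for the latter. *)
Lemma norm_le_norm2 (x : 'rV[R]_d) : `|x| <= norm2 x.
Proof.
rewrite -[`|x|]/(mx_norm x).
have [->|/mx_norm_neq0 [[i j] ->] /=] := eqVneq (mx_norm x) 0.
  exact: sqrtr_ge0.
rewrite /norm2 -sqrtr_sqr ler_wsqrtr// ord1 (bigD1 j)//= lerDl.
by apply: sumr_ge0 => k _; exact: sqr_ge0.
Qed.

Lemma measurable_coord (i : 'I_d) :
  measurable_fun setT (fun x : 'rV[R]_d => x 0 i).
Proof.
apply: (measurability _ (RGenOpens.measurableE R)) => _ [_ [a [b ->] <-]].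
rewrite setTI; apply: open_measurable_rV.
apply: open_comp; last exact: interval_open.
by move=> x _; exact: coord_continuous.
Qed.

(** Continuity alone does not give this, because the sigma-algebra on the pairs
    is generated by rectangles and not by open sets. Every open set is a
    countable union of sup-norm balls, and the preimage of such a ball is a
    finite intersection of conditions on the real functions
    (x, y) |-> x_i - y_i. *)
Lemma measurable_subrV :
  measurable_fun setT (fun z : 'rV[R]_d * 'rV[R]_d => z.1 - z.2).
Proof.
apply: (@measurability _ _ _ _ _ _ (@open 'rV[R]_d)) => // _ [U oU <-].
rewrite setTI (open_bigcup_ball oU) bigcup_mkcond preimage_bigcup.
apply: countable_bigcupT_measurable => // -[q k].
case: ifPn => _; last by rewrite preimage_set0.
set c := map_mx _ _; set r := _^-1.
have r0 : 0 < r by rewrite invr_gt0.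
rewrite [X in measurable X](_ : _ = \bigcap_(i in [set: 'I_d])
  ((fun z : 'rV[R]_d * 'rV[R]_d => z.1 0 i - z.2 0 i) @^-1` ball (c 0 i) r)).
  apply: fin_bigcap_measurable => // i _; rewrite -[X in measurable X]setTI.
  apply: measurable_funB => //; last exact: measurable_ball.
  - exact: measurableT_comp (measurable_coord i) measurable_fst.
  - exact: measurableT_comp (measurable_coord i) measurable_snd.
apply/seteqP; split=> -[x y] /=.
  by move=> [_ xy] i _; have := xy 0 i; rewrite !mxE.
by move=> xy; split=> // j i; rewrite ord1 !mxE; have := xy i I; rewrite !mxE.
Qed.

Lemma closed_norm_ball (K : R) : closed [set x : 'rV[R]_d | `|x| <= K].
Proof.
rewrite (_ : mkset _ = (fun x : 'rV[R]_d => `|x|) @^-1` [set t | t <= K])//.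
apply: preimage_closed; last exact: closed_le.
by move=> x _; exact: norm_continuous.
Qed.

Lemma measurable_norm_ball (K : R) :
  measurable [set x : 'rV[R]_d | `|x| <= K].
Proof.
rewrite -[X in measurable X]setCK; apply: measurableC.
by apply: open_measurable_rV; apply: closed_openC; exact: closed_norm_ball.
Qed.

Lemma probability_norm_ball_cvg (P : probability 'rV[R]_d R) :
  P [set x | `|x| <= n%:R] @[n --> \oo] --> 1%E.
Proof.
have cover : \bigcup_n [set x : 'rV[R]_d | `|x| <= n%:R] = setT.
  apply/seteqP; split=> // x _; exists (Num.bound `|x|) => //.
  exact: ltW (archi_boundP (normr_ge0 x)).
rewrite -(probability_setT P) -cover.
apply: nondecreasing_cvg_mu.
- by move=> n; exact: measurable_norm_ball.
- by rewrite cover.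
- move=> m n mn; apply/subsetPset => x /= /le_trans; apply.
  by rewrite ler_nat.
Qed.

Lemma compactly_supported_ball (P : probability 'rV[R]_d R) (K : R) :
  P (~` [set x | `|x| <= K]) = 0%E -> compactly_supported P.
Proof.
move=> PK; apply: bounded_closed_compact.
  exists K; split; first by rewrite num_real.
  move=> M KM x /= suppx; rewrite leNgt; apply/negP => Mx.
  have := suppx (~` [set x | `|x| <= K]); rewrite PK ltxx => absurd.
  suff // : false by [].
  apply: absurd; last by move=> /=; apply/negP; rewrite -ltNge (lt_trans KM).
  by apply: closed_openC; exact: closed_norm_ball.
rewrite -[measure_support P]setCK; apply: open_closedC.
rewrite openE => x /= /existsNP [U /not_implyP [oU /not_implyP [Ux PU]]].
apply: filterS (open_nbhs_nbhs (conj oU Ux)) => y Uy /(_ U oU Uy).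
exact: PU.
Qed.

End euclidean.

(** * The interaction energy *)

Section energy.
Context {R : realType} {d : nat} (W : 'rV[R]_d -> \bar R) (c : R).
Hypotheses (mW : measurable_fun setT W) (c_le0 : c <= 0)
  (W_ge : forall x, (c%:E <= W x)%E).

Definition shifted_kernel (z : 'rV[R]_d * 'rV[R]_d) : \bar R :=
  (W (z.1 - z.2)%R - c%:E)%E.

Lemma measurable_shifted_kernel : measurable_fun setT shifted_kernel.
Proof.
by apply: emeasurable_funB => //; exact: measurableT_comp mW measurable_subrV.
Qed.

Lemma shifted_kernel_ge0 z : (0 <= shifted_kernel z)%E.
Proof. by rewrite sube_ge0. Qed.

Lemma energy_interaction (P : probability 'rV[R]_d R) :
  energy W P = ((2^-1)%:E * (interaction shifted_kernel P P + c%:E))%E.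
Proof.
rewrite -(interactionE measurable_shifted_kernel shifted_kernel_ge0).
congr (_ * _)%E.
apply: (@integral_shift_bounded_below _ _ _ (P \x P)%E
  (fun z => W (z.1 - z.2)%R)) => //.
exact: measurableT_comp mW measurable_subrV.
Qed.

Lemma le_energy (P Q : probability 'rV[R]_d R) :
  (energy W P <= energy W Q)%E =
  (interaction shifted_kernel P P <= interaction shifted_kernel Q Q)%E.
Proof.
by rewrite !energy_interaction lee_pmul2l ?lte_fin ?invr_gt0// leeD2rE.
Qed.

(** If x is far from the origin, then x - y is far from it for every y in a
    fixed ball, so the potential at x is at least l times the mass of that ball;
    this mass is close enough to 1 once the ball is large, as r < l. *)
Lemma potential_ge_far (P : probability 'rV[R]_d R) (l : R) (r M : R) :
  0 <= r -> r < l -> (forall x, M < norm2 x -> (l%:E <= W x - c%:E)%E) ->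
  exists2 K : R, (0 < P [set x | `|x| <= K]%R)%E &
    forall x, ~ `|x| <= K -> (r%:E <= potential shifted_kernel P x)%E.
Proof.
move=> r0 rl Wl.
have l0 : 0 < l := le_lt_trans r0 rl.
have [n Pn] : exists n : nat, ((r / l)%:E < P [set x | `|x| <= n%:R]%R)%E.
  have : nbhs (1%E : \bar R) [set y | ((r / l)%:E < y)%E].
    apply: open_nbhs_nbhs; split; first exact: open_ereal_gt_ereal.
    by rewrite /= lte_fin ltr_pdivrMr// mul1r.
  by move=> /(probability_norm_ball_cvg P) [N _ /(_ N (leqnn N))]; exists N.
have n0 : (0 < P [set x | (`|x| <= n%:R)%R])%E.
  by apply: le_lt_trans Pn; rewrite lee_fin divr_ge0// ltW.
(* If |x| > n + |M| and |y| <= n, then |x - y| > |M| >= M. *)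
exists (n%:R + `|M|).
  apply: lt_le_trans n0 _; apply: le_measure; rewrite ?inE;
    try exact: measurable_norm_ball.
  by move=> x /= /le_trans; apply; rewrite lerDl.
move=> x /negP; rewrite -ltNge => xK.
set B := [set y : 'rV[R]_d | `|y| <= n%:R] in Pn n0.
have mB : measurable B by exact: measurable_norm_ball.
have mV : measurable_fun setT (fun y => shifted_kernel (x, y)).
  by apply: measurableT_comp measurable_shifted_kernel _; exact: pair1_measurable.
have -> : r%:E = (l%:E * (r / l)%:E)%E by rewrite -EFinM mulrC divfK ?gt_eqF.
apply: (@le_trans _ _ (l%:E * P B)%E).
  by rewrite lee_pmul2l ?lte_fin// ltW.
rewrite -integral_cst//.
apply: (@le_trans _ _ (\int[P]_(y in B) shifted_kernel (x, y))%E).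
  apply: ge0_le_integral => //.
  - by move=> y _; rewrite lee_fin ltW.
  - exact: measurable_funS mV.
  move=> y By; apply: Wl => /=.
  apply: lt_le_trans (norm_le_norm2 _).
  apply: le_lt_trans (ler_norm _) _.
  apply: lt_le_trans (lerB_dist _ _).
  by rewrite ltrBrDl (le_lt_trans _ xK)// lerD2r.
apply: ge0_subset_integral => // y _; exact: shifted_kernel_ge0.
Qed.

End energy.

Theorem corollary1p5 (R : realType) (d : nat) (d_ge1 : (1 <= d)%N)
    (W : 'rV[R]_d -> \bar R) (W_meas : measurable_fun [set: 'rV[R]_d] W)
    (Wmin : R) (Wmin_lt0 : Wmin < 0) (W_bounded : forall x, (Wmin%:E <= W x)%E)
    (W_locint : forall (c : 'rV[R]_d) (r : R),
      (\int[lebesgue_rV d]_(x in ball2 c r) `|W x| < +oo)%E)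
    (W_sym : forall x, W x = W (- x))
    (Winf : \bar R) (W_cvg : W x @[x --> norm2_pinfty] --> Winf)
    (W_unstable : exists mu : probability 'rV[R]_d R,
      (energy W mu < (2^-1)%:E * Winf)%E)
    (W_lsc : lower_semicontinuous W)
    (rho : probability 'rV[R]_d R) (rho_min : global_minimiser W rho) :
  compactly_supported rho.
Proof.
have W0 : Wmin <= 0 := ltW Wmin_lt0.
pose V := shifted_kernel W Wmin.
have V0 z : (0 <= V z)%E by exact: shifted_kernel_ge0.
have mV : measurable_fun setT V by exact: measurable_shifted_kernel.
have Vsym x y : V (x, y) = V (y, x).
  by rewrite /V /shifted_kernel /= W_sym opprB.
have min_rho M : (interaction V rho rho <= interaction V M M)%E.
  by rewrite -le_energy.
have I0 := interaction_ge0 V0 rho rho.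
have IWinf : (interaction V rho rho + Wmin%:E < Winf)%E.
  have [mu mu_lt] := W_unstable; have := le_lt_trans (rho_min mu) mu_lt.
  rewrite (energy_interaction W_meas W0 W_bounded).
  by rewrite lte_pmul2l ?lte_fin ?invr_gt0.
have Ifin : interaction V rho rho \is a fin_num.
  rewrite ge0_fin_numE// ltey; apply/negP => /eqP Ioo.
  by move: IWinf; rewrite Ioo addye// ltNge leey.
set e := interaction V rho rho in IWinf I0 Ifin min_rho.
have [l el lW] : exists2 l : R, (e < l%:E)%E & (l%:E + Wmin%:E < Winf)%E.
  move: IWinf; rewrite -(fineK Ifin) -EFinD.
  case: Winf {W_cvg W_unstable} => [w| |].
  - rewrite lte_fin => ew; exists ((fine e + (w - Wmin)) / 2).
      by rewrite lte_fin; lra.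
    by rewrite -EFinD lte_fin; lra.
  - by move=> _; exists (fine e + 1); rewrite ?lte_fin ?ltrDl// -EFinD ltry.
  - by rewrite ltNge leNye.
have [M _ WM] : norm2_pinfty [set x : 'rV[R]_d | (l%:E + Wmin%:E < W x)%E].
  apply: (W_cvg [set y | (l%:E + Wmin%:E < y)%E]).
  by apply: open_nbhs_nbhs; split => //; exact: open_ereal_gt_ereal.
pose r := (fine e + l) / 2.
have [er rl] : fine e < r /\ r < l.
  by move: el; rewrite -(fineK Ifin) lte_fin /r; split; lra.
have r0 : 0 <= r by rewrite (le_trans _ (ltW er))// fine_ge0.
have [|K K0 Kpot] := potential_ge_far (M := M) W_meas W_bounded rho r0 rl.
  by move=> x /WM /ltW; rewrite leeBrDr.
apply: (@compactly_supported_ball _ _ _ K).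
apply: (@minimiser_concentrated _ _ _ V mV V0 Vsym rho _ r) => //.
  exact: measurable_norm_ball.
by rewrite -/e -(fineK Ifin) lte_fin.
Qed.
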